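(* A countably-based $T_1$-space $\mathbf{X}$ is quasi-Polish if and only if $\mathrm{VC}_{\mathbf{X}}$ is continuous.
   Context: A represented space $\mathbf{X}=(X,\delta_X)$ is a set $X$ with a partial surjection $\delta_X:\subseteq\mathbb{N}^{\mathbb{N}}\to X$. A partial multivalued function $f:\subseteq\mathbf{X}\rightrightarrows\mathbf{Y}$ between represented spaces is continuous if it has a continuous realizer, i.e. a continuous partial $F:\subseteq\mathbb{N}^{\mathbb{N}}\to\mathbb{N}^{\mathbb{N}}$ with $\delta_Y(F(p))\in f(\delta_X(p))$ for all $p\in\mathrm{dom}(f\circ\delta_X)$. A countably-based ($T_0$) topological space $\mathbf{X}$ with countable basis $(B_n)_{n\in\mathbb{N}}$ is regarded as a represented space by its standard (admissible) representation: a name of $x$ is an enumeration of $\{n\mid x\in B_n\}$. $\mathcal{V}(\mathbf{X})$ is the space of closed subsets of $\mathbf{X}$, where a name of a closed set $A$ is an enumeration of $\{n\in\mathbb{N}\mid B_n\cap A\neq\emptyset\}$. Overt choice $\mathrm{VC}_{\mathbf{X}}:\subseteq\mathcal{V}(\mathbf{X})\rightrightarrows\mathbf{X}$ has domain $\{A\in\mathcal{V}(\mathbf{X})\mid A\neq\emptyset\}$, and $x\in\mathrm{VC}_{\mathbf{X}}(A)$ iff $x\in A$. (Continuity of $\mathrm{VC}_{\mathbf{X}}$ does not depend on the choice of the basis.) A topological space is quasi-Polish if it is homeomorphic to a (boldface) $\boldsymbol{\Pi}^0_2$-subspace of the power set of $\mathbb{N}$ with the Scott topology, where a $\boldsymbol{\Pi}^0_2$-subset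 of a space $Z$ is a set of the form $\{z\in Z\mid\forall n\ (z\in U_n\Rightarrow z\in V_n)\}$ with sequences of open sets $(U_n)_n,(V_n)_n$. Equivalently, it is a countably-based completely quasi-metrizable space. *)

(* Defs.v *)
From HB Require Import structures.
From mathcomp Require Import all_boot all_order all_algebra.
From mathcomp Require Import all_classical all_reals all_analysis.

Set Implicit Arguments.
Unset Strict Implicit.
Unset Printing Implicit Defensive.

Local Open Scope classical_set_scope.

Definition powerset_scott (T : Type) : Type := set T.

Section ScottTopology.
Variable T : Type.

Definition directed_family (D : set (set T)) : Prop :=
  D !=set0 /\
  forall A B, D A -> D B -> exists2 C, D C & A `<=` C /\ B `<=` C.

(* Suprema in the poset of subsets are unions. *)
Definition scott_open (U : set (set T)) : Prop :=
  (forall A B : set T, A `<=` B -> U A -> U B) /\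
  (forall D : set (set T), directed_family D ->
     U (\bigcup_(A in D) A) -> exists2 A, D A & U A).

Lemma scott_openT : scott_open setT.
Proof. by split=> // D [[A DA] _] _; exists A. Qed.

Lemma scott_openI : setI_closed scott_open.
Proof.
move=> U V [Uup Usup] [Vup Vsup]; split.
  by move=> A B AB [UA VA]; split; [exact: Uup AB UA|exact: Vup AB VA].
move=> D dirD [/(Usup _ dirD)[A DA UA] /(Vsup _ dirD)[B DB VB]].
have [C DC [AC BC]] := dirD.2 _ _ DA DB.
by exists C => //; split; [exact: Uup AC UA|exact: Vup BC VB].
Qed.

Lemma scott_open_bigcup (I : Type) (f : I -> set (set T)) :
  (forall i, scott_open (f i)) -> scott_open (\bigcup_i f i).
Proof.
move=> fo; split=> [A B AB [i _ fiA]|D dirD [i _ fiD]].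
  by exists i => //; exact: (fo i).1 AB fiA.
by have [A DA fiA] := (fo i).2 _ dirD fiD; exists A => //; exists i.
Qed.

HB.instance Definition _ := gen_eqMixin (powerset_scott T).
HB.instance Definition _ := gen_choiceMixin (powerset_scott T).
HB.instance Definition _ := @isOpenTopological.Build (powerset_scott T)
  scott_open scott_openT scott_openI scott_open_bigcup.

End ScottTopology.

(* The boldface class: sequences of open sets, no effectivity; on general (not
   necessarily metrizable) spaces this is not the same as being a G_delta. *)
Definition Pi02 (Z : topologicalType) (A : set Z) : Prop :=
  exists U V : nat -> set Z,
    [/\ forall n, open (U n), forall n, open (V n)
      & A = [set z | forall n, U n z -> V n z]].

Definition homeomorphic (X Y : topologicalType) : Prop :=
  exists (f : X -> Y) (g : Y -> X),
    [/\ continuous f, continuous g, cancel f g & cancel g f].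

(* The coercion of S to a type carries the subspace topology. *)
Definition quasi_polish (X : topologicalType) : Prop :=
  exists2 S : set (powerset_scott nat), Pi02 S & homeomorphic X S.

Definition baire : topologicalType := {ptws nat -> nat}.

(* The partial surjection from Baire space is given by its graph:
   [is_name p x] means that p is in its domain and is mapped to x. *)
Record represented_space := RepresentedSpace {
  carrier :> Type ;
  is_name : baire -> carrier -> Prop ;
  is_name_functional : forall p x y, is_name p x -> is_name p y -> x = y ;
  is_name_surjective : forall x, exists p, is_name p x
}.

(* A partial multivalued function sends x to a set of values, and x is in its
   domain iff that set is nonempty. *)
Definition multifunction (X Y : represented_space) := X -> set Y.

Definition mf_dom (X Y : represented_space) (f : multifunction X Y) : set X :=
  [set x | f x !=set0].

(* The partial function on Baire space is F restricted to D; the values of F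
   outside D are irrelevant. *)
Definition mf_continuous (X Y : represented_space) (f : multifunction X Y) :
    Prop :=
  exists (D : set baire) (F : baire -> baire),
    {within D, continuous F} /\
    forall (p : baire) (x : X), is_name p x -> mf_dom f x ->
      D p /\ exists2 y : Y, is_name (F p) y & f x y.

(* Enumerations are shifted by one, the entry 0 giving no information, so that
   the empty set also has an enumeration. *)
Definition enumerates (p : baire) (S : set nat) : Prop :=
  S = [set n | exists k, p k = n.+1].

Lemma enumerates_exists (S : set nat) : exists p, enumerates p S.
Proof.
exists (fun n => if `[< S n >] then n.+1 else 0).
apply/seteqP; split=> n /=.
  by move=> Sn; exists n; rewrite asboolT.
by move=> [k]; case: asboolP => // Sk [<-].
Qed.

Section OvertChoice.
Variables (X : topologicalType) (B : nat -> set X).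
Hypotheses (basisB : basis (range B)) (T0X : kolmogorov_space X).

Definition point_name (p : baire) (x : X) : Prop :=
  enumerates p [set n | B n x].

Lemma basis_sub (U : set X) (x : X) :
  open U -> U x -> exists2 n, B n x & B n `<=` U.
Proof.
move=> oU Ux; have /basisB.2[V [[n _ <-] Bnx] BU] : nbhs x U.
  exact: open_nbhs_nbhs.
by exists n.
Qed.

Lemma point_name_functional p x y : point_name p x -> point_name p y -> x = y.
Proof.
rewrite /point_name /enumerates => <- /seteqP[yx xy].
apply: contrapT => /eqP /T0X[A].
have sep u v : (forall n, B n u -> B n v) -> A \in nbhs u -> v \in ~` A -> False.
  move=> uv /set_mem; rewrite nbhsE => -[U [oU Uu] UA] /set_mem; apply.
  by apply: UA; have [n /uv Bv] := basis_sub oU Uu; apply.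
by case=> -[]; [exact: sep xy|exact: sep yx].
Qed.

Lemma point_name_surjective x : exists p, point_name p x.
Proof. exact: enumerates_exists. Qed.

Definition point_space : represented_space :=
  RepresentedSpace point_name_functional point_name_surjective.

Definition overt_name (p : baire) (A : {A : set X | closed A}) : Prop :=
  enumerates p [set n | B n `&` sval A !=set0].

Lemma overt_name_functional p A A' :
  overt_name p A -> overt_name p A' -> A = A'.
Proof.
case: A A' => [A cA] [A' cA']; rewrite /overt_name /enumerates /= => <-.
move=> /seteqP[A'A AA'].
have sub C C' : closed C' ->
    (forall n, B n `&` C !=set0 -> B n `&` C' !=set0) -> C `<=` C'.
  move=> cC' CC' x Cx; apply: cC' => U; rewrite nbhsE => -[V [oV Vx] VU].
  have [n Bnx BV] := basis_sub oV Vx.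
  have [|y [Bny C'y]] := CC' n; first by exists x.
  by exists y; split=> //; apply/VU/BV.
have E : A = A' by apply/seteqP; split; [exact: sub AA'|exact: sub A'A].
by case: _ / E cA' => cA'; congr exist; exact: Prop_irrelevance.
Qed.

Lemma overt_name_surjective A : exists p, overt_name p A.
Proof. exact: enumerates_exists. Qed.

Definition overt_space : represented_space :=
  RepresentedSpace overt_name_functional overt_name_surjective.

Definition overt_choice : multifunction overt_space point_space :=
  fun A : {A : set X | closed A} => [set x : X | sval A x].

End OvertChoice.

Arguments point_space {X B} basisB T0X.
Arguments overt_space {X B} basisB.
Arguments overt_choice {X B} basisB T0X.

(* Main.v *)
Require Import Defs.
From mathcomp Require Import all_boot all_order all_algebra.
From mathcomp Require Import all_classical all_reals all_analysis.

(** Suppose first that overt choice has a continuous realizer F. Say that a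
    finite sequence s forces an open set U if F sends every overt name of a
    nonempty closed set extending s to a name of a point of U. If s forces an
    intersection C of basic sets and x in C lies in every basic set listed by s
    that is contained in C, then s extends to a name of the set
    {x} u (X \ C), closed since X is T1, and F must return x. Hence the
    filters of basic neighbourhoods of points satisfy [forcing_rule], a Pi02
    condition. Conversely, let z be a filter satisfying it and two simpler
    rules. Either some finite intersection of members of z is a singleton, and
    z is the filter of its point, or the closure A of the complement of the
    intersection of z meets every member of z; then, using the forcing rule,
    one builds a name of A on which F is forced into every member of z, and F
    returns a point whose filter is exactly z.

    For the other implication, embed X in the power set of nat as a Pi02 set.
    Given a name of A, search for an increasing sequence of finite sets, each
    contained in the image of some point of A, that fulfils the implications
    "U n implies V n" one after the other. Its union is the image of a point of
    X, which is a limit of points of A. *)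

Set Implicit Arguments.
Unset Strict Implicit.
Unset Printing Implicit Defensive.

Local Open Scope classical_set_scope.

(** * Baire space through finite prefixes *)

Lemma take_mkseq (T : Type) (f : nat -> T) m n :
  m <= n -> take m (mkseq f n) = mkseq f m.
Proof. by move=> mn; rewrite /mkseq -map_take take_iota (minn_idPl mn). Qed.

Lemma nbhs_baire (p : baire) (A : set baire) :
  nbhs p A <-> exists l, forall q : baire, mkseq q l = mkseq p l -> A q.
Proof.
split; last first.
  move=> [l lA]; suff : nbhs p [set q : baire | mkseq q l = mkseq p l].
    exact: filterS.
  elim: l {lA} => [|l IH]; first by apply: filterS filterT.
  have pl : nbhs p [set q : baire | q l = p l].
    apply: (@proj_continuous nat (fun=> nat) l p [set p l]).
    exact/open_nbhs_nbhs/(conj (discrete_open _)).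
  by apply: filterS (filterI IH pl) => q [/= ql e]; rewrite !mkseqS ql e.
(* The cylinders around p generate a filter that converges to p in each coordinate. *)
pose G : set_system baire :=
  filter_from setT (fun l => [set q : baire | mkseq q l = mkseq p l]).
have FG : Filter G.
  apply: filter_from_filter; first by exists 0.
  move=> i j _ _; exists (maxn i j) => // q /= e.
  have [ei ej] := (leq_maxl i j, leq_maxr i j).
  by split; rewrite -?(take_mkseq _ ei) -?(take_mkseq _ ej) e.
suff Gp : {ptws, G --> p} by move=> /Gp [l _ lA]; exists l.
apply/(@pointwise_cvgP nat nat) => t W /nbhs_singleton Wt.
exists t.+1 => // q /= /(congr1 (nth 0 ^~ t)).
by rewrite !nth_mkseq // /= => ->.
Qed.

Lemma within_baire_continuousP (D : set baire) (F : baire -> baire) :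
  {within D, continuous F} <->
  forall p, D p -> forall k, exists l, forall q, D q ->
    mkseq q l = mkseq p l -> F q k = F p k.
Proof.
rewrite subspace_continuousP; split=> [cF p Dp k|cF p Dp].
  have : nbhs (F p) [set q : baire | q k = F p k].
    apply/nbhs_baire; exists k.+1 => q /(congr1 (nth 0 ^~ k)).
    by rewrite !nth_mkseq.
  move=> /(cF p Dp) /nbhs_baire [l H].
  by exists l => q Dq /H; exact.
move=> W /nbhs_baire [l lW].
suff [l' H] : exists l', forall q, D q ->
    mkseq q l' = mkseq p l' -> mkseq (F q) l = mkseq (F p) l.
  by apply/nbhs_baire; exists l' => q e Dq; apply: lW; exact: H.
elim: l {W lW} => [|l [l1 IH]]; first by exists 0.
have [l2 H] := cF p Dp l; exists (maxn l1 l2) => q Dq e.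
have [e1 e2] := (leq_maxl l1 l2, leq_maxr l1 l2).
rewrite !mkseqS; congr rcons.
  by apply: IH => //; rewrite -!(take_mkseq _ e1) e.
by apply: H => //; rewrite -!(take_mkseq _ e2) e.
Qed.

(** * The Scott topology on a power set *)

Section Scott.
Variable T : eqType.
Implicit Types (U : set (powerset_scott T)) (s : seq T) (z : set T).

Definition above s : set (powerset_scott T) := [set z | [set` s] `<=` z].

Lemma scott_openE U : open U = scott_open U.
Proof. by []. Qed.

Lemma scott_open_up U (y z : set T) : open U -> y `<=` z -> U y -> U z.
Proof. by rewrite scott_openE => -[up _]; exact: up. Qed.

(** Every set is the directed union of its finite subsets. *)
Lemma scott_open_finite U z :
  open U -> U z -> exists2 s : seq T, [set` s] `<=` z & U [set` s].
Proof.
rewrite scott_openE => -[_ Usup].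
pose D := [set A | exists2 s : seq T, [set` s] `<=` z & A = [set` s]].
have Dz : \bigcup_(A in D) A = z.
  apply/seteqP; split=> [x [_ [s sz ->]] /sz //|x zx].
  exists [set` ([:: x] : seq T)]; last by rewrite /= inE.
  by exists [:: x] => // y; rewrite /= inE => /eqP ->.
have dirD : directed_family D.
  split; first by exists [set` ([::] : seq T)]; exists [::].
  move=> _ _ [s sz ->] [t tz ->]; exists [set` (s ++ t : seq T)].
    by exists (s ++ t) => // x; rewrite /= mem_cat => /orP[/sz|/tz].
  by split=> x; rewrite /= mem_cat => ->; rewrite ?orbT.
rewrite -Dz => /(Usup _ dirD) [_ [s sz ->] Us].
by exists s => //; rewrite Dz.
Qed.

Lemma open_above s : open (above s).
Proof.
rewrite scott_openE; split=> [A B AB sA|D [[A0 DA0] dirD] sD].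
  exact: subset_trans AB.
elim: s sD => [_|x s IH sD]; first by exists A0.
have [|A DA sA] := IH; first by move=> y ys; apply: sD; rewrite /= inE ys orbT.
have [B DB Bx] : (\bigcup_(A in D) A) x by apply: sD; rewrite /= mem_head.
have [C DC [AC BC]] := dirD _ _ DA DB; exists C => // y.
by rewrite /= inE => /orP[/eqP ->|/sA]; [exact: BC|exact: AC].
Qed.

Lemma nbhs_scott z U :
  nbhs (z : powerset_scott T) U <->
  exists2 s : seq T, [set` s] `<=` z & above s `<=` U.
Proof.
split=> [|[s sz sU]].
  rewrite nbhsE => -[V [oV Vz] VU].
  have [s sz Vs] := scott_open_finite oV Vz; exists s => // A sA.
  by apply: VU; exact: scott_open_up sA Vs.
by apply: filterS sU _; apply: open_nbhs_nbhs; split=> //; exact: open_above.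
Qed.

End Scott.
Arguments above {T} s.

(** * Closure properties of Pi02 sets *)

Lemma Pi02I (Z : topologicalType) (A B : set Z) :
  Pi02 A -> Pi02 B -> Pi02 (A `&` B).
Proof.
move=> [U [V [oU oV ->]]] [U' [V' [oU' oV' ->]]].
exists (fun n => if odd n then U n./2 else U' n./2).
exists (fun n => if odd n then V n./2 else V' n./2).
split; [by move=> n; case: odd|by move=> n; case: odd|].
apply/seteqP; split=> z /= => [[zA zB] n|H].
  by case: odd; [exact: zA|exact: zB].
split=> n.
  by have := H n.*2.+1; rewrite /= odd_double /= uphalf_double.
by have := H n.*2; rewrite odd_double doubleK.
Qed.

Lemma Pi02_countable (Z : topologicalType) (I : countType) (U V : I -> set Z) :
  (forall i, open (U i)) -> (forall i, open (V i)) ->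
  Pi02 [set z | forall i, U i z -> V i z].
Proof.
move=> oU oV.
pose ext (W : I -> set Z) n := if unpickle n is Some i then W i else setT.
exists (ext U), (ext V); split=> [n|n|]; rewrite /ext.
- by case: unpickle => // *; exact: openT.
- by case: unpickle => // *; exact: openT.
apply/seteqP; split=> z /= H => [n|i]; first by case: unpickle.
by have := H (pickle i); rewrite pickleK.
Qed.

(** * Embedding by neighbourhood filters *)

Section CountableBase.
Variables (X : topologicalType) (B : nat -> set X).
Hypotheses (basisB : basis (range B)) (T0X : kolmogorov_space X).
Implicit Types (s t : seq nat) (x y : X).

Definition base_filter x : powerset_scott nat := [set n | B n x].

Definition capB s : set X := \bigcap_(n in [set` s]) B n.

Lemma open_B n : open (B n).
Proof. by apply: basisB.1; exists n. Qed.

Lemma capB_nil : capB [::] = setT.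
Proof. by apply/seteqP; split=> // x _ n. Qed.

Lemma capB_cons n s : capB (n :: s) = B n `&` capB s.
Proof.
apply/seteqP; split=> x.
  by move=> sx; split=> [|m ms]; apply: sx; rewrite /= inE ?eqxx // ms orbT.
by move=> [Bx sx] m; rewrite /= inE => /orP[/eqP -> //|/sx].
Qed.

Lemma open_capB s : open (capB s).
Proof.
elim: s => [|n s IH]; first by rewrite capB_nil; exact: openT.
by rewrite capB_cons; exact: openI (open_B n) IH.
Qed.

Lemma above_base_filter s x : above s (base_filter x) <-> capB s x.
Proof. by []. Qed.

Lemma base_filter_inj : injective base_filter.
Proof.
move=> x y exy; have [p px] := enumerates_exists (base_filter x).
apply: (point_name_functional basisB T0X px).
by rewrite /point_name -/(base_filter y) -exy.
Qed.

Lemma base_filter_continuous : continuous base_filter.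
Proof.
move=> x U /nbhs_scott [s /above_base_filter sx sU].
have : nbhs x (capB s) by apply: open_nbhs_nbhs; split=> //; exact: open_capB.
by apply: filterS => y /above_base_filter; exact: sU.
Qed.

(** The inverse of [base_filter] is continuous because B n corresponds to the trace of [above
    [:: n]]. *)
Lemma quasi_polish_base_filter : Pi02 (range base_filter) -> quasi_polish X.
Proof.
move=> Pi; exists (range base_filter) => //.
have ex (z : range base_filter) : exists x, base_filter x = set_val z.
  by have /set_mem [x _ xz] := valP z; exists x.
pose f x : range base_filter := SigSub (mem_set (imageT base_filter x)).
pose g z := sval (cid (ex z)).
have gE z : base_filter (g z) = set_val z by rewrite /g; case: cid.
exists f, g; split.
- exact/continuous_comp_initial/base_filter_continuous.
- move=> z U; rewrite nbhsE => -[V [oV Vgz] VU].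
  have [n Bn BV] := basis_sub basisB oV Vgz.
  have zn : above [:: n] (base_filter (g z)).
    by move=> m; rewrite /= inE => /eqP ->.
  exists (set_val @^-1` above [:: n]); split.
  + by exists (above [:: n]) => //; exact: open_above.
  + by rewrite /= -gE.
  move=> w /=; rewrite -gE => wn; apply/VU/BV.
  by apply: (wn n); rewrite /= inE.
- by move=> x; apply: base_filter_inj; rewrite gE.
- by move=> z; apply: val_inj; rewrite /= gE.
Qed.

End CountableBase.

(** * Enumerations and limits of growing prefixes *)

Lemma enumeratesP (p : baire) (S : set nat) :
  enumerates p S <-> forall n, S n <-> exists k, p k = n.+1.
Proof.
rewrite /enumerates; split=> [-> //|H].
by apply/seteqP; split=> n /H.
Qed.

(** Entry k is read off [s k.+1], which has more than k entries, so the default x0 is never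
    reached. *)
Lemma prefix_chain_limit (T : eqType) (x0 : T) (s : nat -> seq T) :
  (forall i, prefix (s i) (s i.+1)) -> (forall i, i <= size (s i)) ->
  exists p : nat -> T, forall i, mkseq p (size (s i)) = s i.
Proof.
move=> ss si; exists (fun k => nth x0 (s k.+1) k) => i.
have mono a b : a <= b -> prefix (s a) (s b).
  move=> /subnK <-; elim: (b - a) => [|d IH]; first exact: prefix_refl.
  exact: prefix_trans IH (ss _).
have agree a b k : a <= b -> k < size (s a) -> nth x0 (s b) k = nth x0 (s a) k.
  by move=> /mono /prefixP [t ->] ka; rewrite nth_cat ka.
apply: (@eq_from_nth _ x0) => [|k]; rewrite size_mkseq // => ki.
rewrite nth_mkseq // -(agree k.+1 (maxn i k.+1)) ?leq_maxr //.
by rewrite (agree i (maxn i k.+1)) ?leq_maxl.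
Qed.

(** * From continuous selections to a Pi02 set of point filters *)

Section Selection.
Variables (X : topologicalType) (B : nat -> set X).
Hypotheses (basisB : basis (range B)) (T1X : accessible_space X).
Variable sel : baire -> X -> Prop.
Hypothesis sel_ex : forall p (A : set X), closed A -> A !=set0 ->
  enumerates p [set n | B n `&` A !=set0] -> exists2 x, A x & sel p x.
Hypothesis sel_cont : forall p x (U : set X), sel p x -> open U -> U x ->
  exists l, forall q y, sel q y -> mkseq q l = mkseq p l -> U y.
Implicit Types (s t k : seq nat) (x y : X) (U V : set X).

Local Notation cap := (capB B).

Definition forces s U := forall p x, sel p x -> mkseq p (size s) = s -> U x.

Lemma forces_cat s t U : forces s U -> forces (s ++ t) U.
Proof.
move=> sU p x px e; apply: (sU p) => //.
rewrite -(@take_mkseq _ _ _ (size (s ++ t))) ?e ?take_size_cat //.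
by rewrite size_cat leq_addr.
Qed.

Lemma sel_forces p x U : sel p x -> open U -> U x ->
  exists l, forall l', l <= l' -> forces (mkseq p l') U.
Proof.
move=> px oU Ux; have [l H] := sel_cont px oU Ux.
exists l => l' ll' q y qy; rewrite size_mkseq => e; apply: H qy _.
by rewrite -!(take_mkseq _ ll') e.
Qed.

(* The entry m.+1 of a name stands for m, the entry 0 for nothing. *)
Definition inner s k : seq nat :=
  [seq w.-1 | w <- s & (0 < w) && `[< B w.-1 `<=` cap k >]].

Lemma innerP s k m : reflect (m.+1 \in s /\ B m `<=` cap k) (m \in inner s k).
Proof.
apply: (iffP mapP) => [[[|w]]|[ms Bm]].
- by rewrite mem_filter.
- by rewrite mem_filter /= => /andP[/asboolP Bw ws] ->.
- by exists m.+1; rewrite // mem_filter ms andbT /=; exact/asboolP.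
Qed.

(* The closed set {x} together with the complement of the intersection of k
   meets all the basic sets in s, and x is its only element that a selection
   forced into that intersection can return. *)
Lemma forces_point s k x : forces s (cap k) -> cap k x ->
  [set` inner s k] `<=` base_filter B x ->
  exists p, [/\ sel p x, mkseq p (size s) = s &
    forall i m, p i = m.+1 -> B m `<=` cap k -> B m x].
Proof.
move=> sk kx sx; pose A := [set x] `|` ~` cap k.
have cA : closed A.
  apply: closedU; first exact: accessible_closed_set1.
  by apply: open_closedC; exact: open_capB.
have hitA m : (B m `<=` cap k -> B m x) -> B m `&` A !=set0.
  move=> H; have [/H Bx|] := pselect (B m `<=` cap k).
    by exists x; split=> //; left.
  by move=> /existsNP [y /not_implyP [By ky]]; exists y; split=> //; right.
have Ahit m : B m `&` A !=set0 -> B m `<=` cap k -> B m x.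
  by move=> [y [By [<- //|ky]]] /(_ _ By).
have [p0 p0A] := enumerates_exists [set n | B n `&` A !=set0].
(* Prepending s to a name of A is harmless: by [sx] the basic sets it lists all meet A. *)
pose p : baire := fun i => if i < size s then nth 0 s i else p0 (i - size s).
have ps : mkseq p (size s) = s.
  apply: (@eq_from_nth _ 0) => [|i]; rewrite size_mkseq // => ilt.
  by rewrite nth_mkseq // /p ilt.
move/enumeratesP : p0A => p0A.
have pA : enumerates p [set n | B n `&` A !=set0].
  apply/enumeratesP => m; split=> [/p0A [i pi]|[i]].
    by exists (i + size s); rewrite /p ltnNge leq_addl /= addnK.
  rewrite /p; case: ifP => [ilt pi|_ pi]; last first.
    by apply/p0A; exists (i - size s).
  apply: hitA => mk; apply: sx; apply/innerP; split=> //.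
  by rewrite -pi mem_nth.
have [|y Ay py] := sel_ex cA _ pA; first by exists x; left.
have yx : y = x by case: Ay => // /(_ (sk _ _ py ps)).
exists p; split=> //; first by rewrite -yx.
move=> i m pi; apply/Ahit.
by have /enumeratesP /(_ m) [_] := pA; apply; exists i.
Qed.


(* Unless k pins down a single point, some member of z is strictly smaller than
   cap k: this excludes the filters of neighbourhoods of larger open sets. *)
Definition refine_rule : set (powerset_scott nat) :=
  [set z | forall k, above k z ->
    (\bigcup_(l in [set l | [/\ B l !=set0, B l `<=` cap k &
      B l = cap k -> exists x, cap k = [set x]]]) above [:: l]) z].

Definition superset_rule : set (powerset_scott nat) :=
  [set z | forall nm : nat * nat,
    B nm.1 `<=` B nm.2 /\ above [:: nm.1] z -> above [:: nm.2] z].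

(** The premises are those of [forces_point], with z for the filter of x, together with n in z. The
    triple is a countable index. *)
Definition forcing_rule : set (powerset_scott nat) :=
  [set z | forall skn : seq nat * seq nat * nat, let: (s, k, n) := skn in
    forces s (cap k) /\ above (n :: k ++ inner s k) z ->
    (\bigcup_(t in [set t | forces (s ++ t) (B n)]) above (inner t k)) z].

Definition point_filters := refine_rule `&` superset_rule `&` forcing_rule.

Lemma Pi02_point_filters : Pi02 point_filters.
Proof.
(* Conditions such as [forces] do not depend on z, so adding one to an open set leaves that set or
   the empty set. *)
have og (P : Prop) (W : set (powerset_scott nat)) :
    open W -> open [set z | P /\ W z].
  move=> oW; have [p|np] := pselect P.
    by rewrite (_ : mkset _ = W) //; apply/seteqP; split=> [z []|z].
  by rewrite (_ : mkset _ = set0); [exact: open0|apply/seteqP; split=> [z []|]].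
apply: Pi02I; first apply: Pi02I.
- apply: (@Pi02_countable _ (seq nat) (fun k => above k)) => k.
    exact: open_above.
  by apply: bigcup_open => l _; exact: open_above.
- apply: (@Pi02_countable _ (nat * nat)%type
    (fun nm => [set z | B nm.1 `<=` B nm.2 /\ above [:: nm.1] z])) => nm.
    exact/og/open_above.
  exact: open_above.
- rewrite (_ : forcing_rule = [set z | forall skn : seq nat * seq nat * nat,
    [set z | forces skn.1.1 (cap skn.1.2) /\
      above (skn.2 :: skn.1.2 ++ inner skn.1.1 skn.1.2) z] z ->
    (\bigcup_(t in [set t | forces (skn.1.1 ++ t) (B skn.2)])
      above (inner t skn.1.2)) z]).
    apply: Pi02_countable => -[[s k] n] /=; first exact/og/open_above.
    by apply: bigcup_open => t _; exact: open_above.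
  by apply/seteqP; split=> z H [[s k] n]; have := H (s, k, n).
Qed.

Lemma above1 n (z : powerset_scott nat) : above [:: n] z <-> z n.
Proof.
split=> [|zn m]; first by apply; rewrite /= inE.
by rewrite /= inE => /eqP ->.
Qed.

Lemma above_cons n s (z : powerset_scott nat) :
  above (n :: s) z <-> z n /\ above s z.
Proof.
split=> [H|[zn zs] m]; last by rewrite /= inE => /orP[/eqP -> //|/zs].
by split=> [|m ms]; apply: H; rewrite /= inE ?eqxx // ms orbT.
Qed.

Lemma above_cat s t (z : powerset_scott nat) :
  above (s ++ t) z <-> above s z /\ above t z.
Proof.
elim: s => [|n s IH]; first by split=> [|[]].
by rewrite cat_cons !above_cons IH and_assoc.
Qed.

Lemma base_filter_point_filters x : point_filters (base_filter B x).
Proof.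
split; first split.
- move=> k kx; have [y|] := pselect (exists2 y, cap k y & y <> x).
    move: y => [y ky /eqP yx]; rewrite eq_sym in yx.
    (* A basic set inside V misses y, hence is a proper subset of [cap k]. *)
    have [V [oV /set_mem Vx /set_mem nVy]] := T1X yx.
    have [||l Bl lV] := @basis_sub _ _ basisB (cap k `&` V) x.
    + by apply: openI => //; exact: open_capB.
    + by split.
    exists l; last exact/above1.
    split; [by exists x|by move=> u /lV []|].
    by move=> e; case: nVy; suff /lV [] : B l y by []; rewrite e.
  move=> nk; have kE : cap k = [set x].
    apply/seteqP; split=> [y ky|y ->]; last exact: kx.
    by apply: contrapT => yx; apply: nk; exists y.
  have [||l Bl lV] := @basis_sub _ _ basisB (cap k) x.
  + exact: open_capB.
  + exact: kx.
  exists l; last exact/above1.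
  by split=> //; exists x.
- by move=> [n m] [nm /above1 Bn]; apply/above1; exact: nm.
move=> [[s k] n] [sk /above_cons [Bn /above_cat [kx sx]]].
have [p [px ps pk]] := forces_point sk kx sx.
have [l H] := sel_forces px (open_B basisB n) Bn.
(* Long enough to extend s and to force B n. *)
pose l' := maxn (size s) l.
have sl' : size s <= l' by exact: leq_maxl.
exists (drop (size s) (mkseq p l')).
  rewrite /= -[X in X ++ _]ps -(take_mkseq p sl') cat_take_drop.
  exact/H/leq_maxr.
move=> m /innerP [/mem_drop /mapP [i _ /esym pi] Bm].
exact: pk pi Bm.
Qed.

(** The refine rule gives l in z with B l inside both [cap k] and [cap (inner s k)]. By
    [forces_point] each point of B l is selected on some name extending s, hence lies in B n. *)
Lemma forces_refine s k n z : refine_rule z -> forces s (cap k) ->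
  forces s (B n) -> above k z -> above (inner s k) z ->
  exists2 l, z l & B l `<=` B n.
Proof.
move=> zr sk sn kz sz.
have [|l [_ lks _] /above1 zl] := zr (k ++ inner s k); first exact/above_cat.
exists l => // x /lks H.
have [kx sx] : above k (base_filter B x) /\ above (inner s k) (base_filter B x).
  by apply/above_cat => m; exact: H.
by have [p [px ps _]] := forces_point sk kx sx; exact: sn px ps.
Qed.


(** One round of the construction: if i is in z, the forcing rule lets i join k; then the basic sets
    of index below i not inside the new intersection are listed. *)
Lemma point_filters_step i s k (z : set nat) :
  point_filters z -> forces s (cap k) -> above k z -> above (inner s k) z ->
  exists s' k', [/\ forces s' (cap k'), above k' z & above (inner s' k') z] /\
    [/\ prefix s s', size s < size s', above k [set` k'], z i -> i \in k' &
      forall n, n < i -> ~ B n `<=` cap k' -> n.+1 \in s'].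
Proof.
move=> [[zr zsup] zf] sk kz sz.
have [t [k' [sk' kz' kk' zi tz]]] : exists t k',
    [/\ forces (s ++ t) (cap k'), above k' z, above k [set` k'],
     z i -> i \in k' & above (inner (s ++ t) k') z].
  have [zi|nzi] := pselect (z i); last first.
    by exists [::], k; rewrite cats0; split.
  have [|t st tz] := zf (s, k, i).
    by split=> //; apply/above_cons; split=> //; apply/above_cat.
  exists t, (i :: k); split.
  - move=> p x px e; rewrite capB_cons; split; first exact: st px e.
    exact: forces_cat sk _ _ px e.
  - exact/above_cons.
  - by move=> m mk; rewrite /= inE mk orbT.
  - by move=> _; rewrite inE eqxx.
  - move=> m /innerP; rewrite mem_cat capB_cons subsetI.
    move=> [/orP[ms|mt] [_ mk]]; first by apply: sz; apply/innerP.
    by apply: tz; apply/innerP.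
(* The 0 makes s' strictly longer; the other entries are not inside [cap k'], so [inner] gains
   nothing. *)
pose u := 0 :: [seq n.+1 | n <- iota 0 i & ~~ `[< B n `<=` cap k' >]].
exists (s ++ t ++ u), k'; split; split=> //.
- by rewrite catA; exact: forces_cat.
- move=> m /innerP; rewrite catA mem_cat => -[+ mk] => /orP[mst|].
    by apply: tz; apply/innerP.
  rewrite /u inE /= => /mapP [n + [mn]].
  by rewrite mem_filter -mn => /andP[/asboolPn].
- exact: prefix_prefix.
- by rewrite !size_cat addnA addnS ltnS -addnA leq_addr.
- move=> n ni nk; rewrite !mem_cat /u inE map_f ?orbT //.
  by rewrite mem_filter mem_iota ni leq0n !andbT; exact/asboolPn.
Qed.

Lemma point_filters_sequence (z : set nat) : point_filters z ->
  exists s k : nat -> seq nat,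
    (forall i, [/\ forces (s i) (cap (k i)), above (k i) z &
       above (inner (s i) (k i)) z]) /\
    (forall i, [/\ prefix (s i) (s i.+1), size (s i) < size (s i.+1),
       above (k i) [set` k i.+1], z i -> i \in k i.+1 &
       forall n, n < i -> ~ B n `<=` cap (k i.+1) -> n.+1 \in s i.+1]).
Proof.
move=> zp.
pose inv (a : seq nat * seq nat) := [/\ forces a.1 (cap a.2), above a.2 z &
  above (inner a.1 a.2) z].
pose step (i : nat) (a b : seq nat * seq nat) :=
  [/\ prefix a.1 b.1, size a.1 < size b.1, above a.2 [set` b.2],
   z i -> i \in b.2 &
   forall n, n < i -> ~ B n `<=` cap b.2 -> n.+1 \in b.1].
(* The invariant is a premise so that the relation is total. *)
have /choice [f fP] : forall ia : nat * (seq nat * seq nat),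
    exists b, inv ia.2 -> inv b /\ step ia.1 ia.2 b.
  move=> [i [s k]]; have [|ninv] := pselect (inv (s, k)); last first.
    by exists (s, k).
  move=> [sk kz sz]; have [s' [k' [i' st]]] := point_filters_step i zp sk kz sz.
  by exists (s', k').
pose run := fix run i := if i is j.+1 then f (j, run j) else ([::], [::]).
have runI i : inv (run i).
  elim: i => [|i IH]; last by have [] := fP (i, run i) IH.
  by split=> //; rewrite /= capB_nil.
exists (fst \o run), (snd \o run); split=> i; first exact: runI.
by have [_] := fP (i, run i) (runI i).
Qed.

Lemma point_filters_sub : point_filters `<=` range (base_filter B).
Proof.
move=> z zp; have [[zr zsup] _] := zp.
have zle n m : z n -> B n `<=` B m -> z m.
  by move=> zn nm; apply/above1/(zsup (n, m)); split=> //; exact/above1.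
have [[k kz [x kx]]|nsing] :=
    pselect (exists2 k, above k z & exists x, cap k = [set x]).
  (* Refining k gives a member of z inside {x}; refining n :: k gives a nonempty one inside both B n
     and {x}. *)
  exists x => //; apply/seteqP; split=> n.
    move=> Bn; have [l [_ lk _] /above1 zl] := zr k kz.
    by apply: (zle l) => //; apply: subset_trans lk _; rewrite kx => _ ->.
  move=> zn; have [|l [[y ly] lnk _] _] := zr (n :: k); first exact/above_cons.
  by have := lnk y ly; rewrite capB_cons kx => -[+ <-].
have smaller m : z m -> exists2 l, z l & ~ B m `<=` B l.
  move=> zm; have zm1 : above [:: m] z by exact/above1.
  have [l [_ lm lE] /above1 zl] := zr _ zm1; exists l => // ml.
  apply: nsing; exists [:: m] => //; apply: lE; apply/seteqP; split=> // x mx.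
  by apply: ml; apply: mx; rewrite /= inE.
have [s [k [inv step]]] := point_filters_sequence zp.
have ssize i : i <= size (s i).
  by elim: i => // i IH; have [_ /(leq_ltn_trans IH)] := step i.
have [|p ps] := prefix_chain_limit 0 _ ssize; first by move=> i; case: (step i).
have kmono i j : i <= j -> above (k i) [set` k j].
  move=> /subnK <-; elim: (j - i) => // d IH m /IH mk.
  by have [_ _ H _ _] := step (d + i); exact: H.
have kin n i : z n -> n < i -> n \in k i.
  by move=> zn ni; have [_ _ _ H _] := step n; apply: (kmono _ _ ni); exact: H.
(* B m meets W iff B m is not contained in some member of z. By [inv] every m
   listed by some s i is a member of z or has this property, and by [smaller]
   the members of z have it as well. *)
pose W := ~` \bigcap_(n in z) B n.
have cW m : B m `&` closure W !=set0 <-> B m `&` W !=set0.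
  split=> [[y [my Wy]]|[y [my Wy]]]; last first.
    by exists y; split=> //; exact: subset_closure.
  rewrite setIC; apply: Wy; apply: open_nbhs_nbhs; split=> //; exact: open_B.
have Wout m l : z l -> ~ B m `<=` B l -> B m `&` W !=set0.
  move=> zl /existsNP [y /not_implyP [my nly]].
  by exists y; split=> // /(_ _ zl).
have pW : enumerates p [set m | B m `&` closure W !=set0].
  apply/enumeratesP => m; split.
    move=> /cW [y [my /existsNP [n /not_implyP [zn ny]]]].
    (* Step i examines m since m < i, and [cap (k i.+1)] lies inside B n since n <= i. *)
    pose i := maxn m.+1 n; have [_ _ _ _ H] := step i.
    have : m.+1 \in s i.+1.
      apply: H => [|mk]; first exact: leq_maxl.
      apply: ny; apply: (mk _ my); apply: kin => //.
      by rewrite ltnS leq_maxr.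
    by rewrite -ps => /mapP [j _ ->]; exists j.
  move=> [j pj]; apply/cW; have [_ kz sz] := inv j.+1.
  have ms : m.+1 \in s j.+1.
    by rewrite -ps -pj map_f // mem_iota ssize.
  have [mk|/existsNP [y /not_implyP [my]]] := pselect (B m `<=` cap (k j.+1)).
    have [|l zl ml] := smaller m; first by apply: sz; apply/innerP.
    exact: Wout ml.
  move=> /existsNP [n /not_implyP [nk ny]].
  by apply: (Wout _ n); [exact: kz|move=> /(_ _ my)].
have [||x _ px] := sel_ex _ _ pW.
- exact: closed_closure.
(* W is nonempty: z has a member, and by [smaller] some member of z does not include it. *)
- have [|l _ /above1 zl] := zr [::]; first by [].
  have [l' zl' ll'] := smaller l zl; have [y [_ Wy]] := Wout _ _ zl' ll'.
  by exists y; exact: subset_closure.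
exists x => //; apply/seteqP; split=> n.
  (* A prefix forcing B n yields, by [forces_refine], a member of z inside B n. *)
  move=> nx; have [l H] := sel_forces px (open_B basisB n) nx.
  have [sk kz sz] := inv l.
  have [|l' zl' l'n] := forces_refine (n := n) zr sk _ kz sz.
    by rewrite -ps; apply: H; exact: ssize.
  exact: zle l'n.
move=> zn; have [sk _ _] := inv n.+1.
by apply: (sk _ _ px (ps _)); exact: kin.
Qed.

Lemma selection_quasi_polish : quasi_polish X.
Proof.
apply: (quasi_polish_base_filter basisB (accessible_kolmogorov T1X)).
suff -> : range (base_filter B) = point_filters by exact: Pi02_point_filters.
apply/seteqP; split; last exact: point_filters_sub.
by move=> _ [x _ <-]; exact: base_filter_point_filters.
Qed.

End Selection.

(** The realizer F induces a selection; it is continuous since a single entry n.+1 of F p witnesses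
    B n and depends on a finite prefix of p. *)
Lemma continuous_overt_choice_quasi_polish (X : topologicalType)
    (B : nat -> set X) (basisB : basis (range B)) (T1X : accessible_space X) :
  mf_continuous (overt_choice basisB (accessible_kolmogorov T1X)) ->
  quasi_polish X.
Proof.
move=> [D [F [/within_baire_continuousP cF FP]]].
have name p (A : {A : set X | closed A}) : sval A !=set0 ->
    overt_name B p A ->
    D p /\ exists2 y, point_name B (F p) y & sval A y.
  by move=> A0 pA; exact: FP p A pA A0.
pose sel (p : baire) x := [/\ D p, point_name B (F p) x &
  exists A, [/\ closed A, A x & enumerates p [set n | B n `&` A !=set0]]].
apply: (@selection_quasi_polish X B basisB T1X sel) => [p A cA A0 pA|p x U].
  have [Dp [y py Ay]] := name p (exist _ A cA) A0 pA.
  by exists y => //; split=> //; exists A.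
move=> [Dp px _] oU Ux; have [n nx nU] := basis_sub basisB oU Ux.
have /enumeratesP /(_ n) [/(_ nx) [j pj] _] := px.
have [l lP] := cF p Dp j; exists l => q y [Dq qy _] /(lP _ Dq) qj.
by apply: nU; have /enumeratesP /(_ n) [_] := qy; apply; exists j; rewrite qj.
Qed.

(** * From a Pi02 embedding to a realizer of overt choice *)

Lemma quasi_polish_embedding (X : topologicalType) : quasi_polish X ->
  exists (h : X -> set nat) (U V : nat -> set (powerset_scott nat)),
  [/\ forall n, open (U n) /\ open (V n),
      forall s, open [set x | above s (h x)],
      forall x W, open W -> W x ->
        exists2 s, above s (h x) & [set y | above s (h y)] `<=` W &
      forall z, (exists x, h x = z) <-> forall n, U n z -> V n z].
Proof.
move=> [S [U [V [oU oV SE]]] [f [g [cf cg fK gK]]]].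
exists (fun x => set_val (f x)), U, V; split=> [n|s|x W oW Wx|z].
- by split.
- have : open ((set_val : S -> powerset_scott nat) @^-1` above s).
    by exists (above s) => //; exact: open_above.
  by move/continuousP : cf; exact.
- have : nbhs (f x) (g @^-1` W).
    by apply: cg; rewrite fK; exact: open_nbhs_nbhs.
  move=> [_ [[G oG <-]] /= Gfx GW].
  have [s sx Gs] := scott_open_finite oG Gfx; exists s => // y sy.
  rewrite /= -(fK y); apply: GW; rewrite /=.
  exact: scott_open_up sy Gs.
- split=> [[x <-]|zUV].
    have SUV w : S w -> forall n, U n w -> V n w by rewrite SE.
    exact/SUV/set_mem/valP.
  have Sz : S z by rewrite SE.
  by exists (g (SigSub (mem_set Sz))); rewrite gK.
Qed.

Section OvertSearch.
Variables (X : topologicalType) (B : nat -> set X).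
Hypotheses (basisB : basis (range B)) (T0X : kolmogorov_space X).
Variables (h : X -> set nat) (U V : nat -> set (powerset_scott nat)).
Hypothesis oUV : forall n, open (U n) /\ open (V n).
Let pre s := [set x | above s (h x)].
Hypothesis open_pre : forall s, open (pre s).
Hypothesis pre_base : forall x W, open W -> W x ->
  exists2 s, above s (h x) & pre s `<=` W.
Hypothesis hUV : forall z, (exists x, h x = z) <-> forall n, U n z -> V n z.

(** A state is a finite part of the limit and a counter. All m below the counter are rechecked at
    each step, since U m may come to hold late. *)
Definition search_step (a b : seq nat * nat) :=
  [/\ b.2 = a.2.+1, above a.1 [set` b.1] &
    forall m, m < b.2 -> U m [set` a.1] -> V m [set` b.1]].

(** An index n listed by a name of A certifies, from finite data, that [pre b.1] meets A. *)
Definition candidates (w : seq nat) (a : seq nat * nat) :=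
  [set b | search_step a b /\ exists2 n, n.+1 \in w & B n `<=` pre b.1].

(* The counter in the second component only moves together with the first one,
   so that a request for finitely many V m stays put until it is met. *)
Fixpoint search (p : baire) t : seq nat * nat :=
  if t is t'.+1 then
    xget (search p t') (candidates (mkseq p t') (search p t'))
  else ([::], 0).

(** Position j codes an index n and a stage t; that stage reads only t entries of p, whence
    continuity. *)
Definition search_output (p : baire) : baire := fun j =>
  if unpickle j is Some (n, t) then
    if `[< pre (search p t).1 `<=` B n >] then n.+1 else 0
  else 0.

Lemma search_local p q t : mkseq q t = mkseq p t -> search q t = search p t.
Proof.
elim: t => // t IH qp.
have e : mkseq q t = mkseq p t by rewrite -!(take_mkseq _ (leqnSn t)) qp.
by rewrite /= IH // e.
Qed.

Lemma search_next p t b : candidates (mkseq p t) (search p t) b ->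
  candidates (mkseq p t) (search p t) (search p t.+1).
Proof. exact: xgetI. Qed.

Lemma search_succ p t :
  candidates (mkseq p t) (search p t) (search p t.+1) \/
  search p t.+1 = search p t.
Proof.
have [[b cb]|nex] := pselect (exists b, candidates (mkseq p t) (search p t) b).
  by left; exact: search_next cb.
by right; apply: xgetPN => b cb; apply: nex; exists b.
Qed.

Lemma search_output_continuous : {within setT, continuous search_output}.
Proof.
apply/within_baire_continuousP => p _ j; rewrite /search_output.
case: unpickle => [[n t]|]; last by exists 0.
by exists t => q _ /search_local ->.
Qed.

(** Since h x fulfils every implication, finite parts of h x witnessing the required V m can be
    added to a.1. *)
Lemma search_step_ex a x : pre a.1 x ->
  exists2 b, search_step a b & pre b.1 x.
Proof.
move=> ax.
have [s [sa sx sV]] : exists s, [/\ above a.1 [set` s], pre s x &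
    forall m, m < a.2.+1 -> U m [set` a.1] -> V m [set` s]].
  elim: a.2.+1 => [|i [s [sa sx sV]]]; first by exists a.1; split=> // m.
  have [Ui|nUi] := pselect (U i [set` a.1]); last first.
    by exists s; split=> // m; rewrite ltnS leq_eqVlt => /orP[/eqP ->|/sV].
  have hV : V i (h x).
    have /hUV : exists y, h y = h x by exists x.
    by apply; exact: scott_open_up (oUV i).1 ax Ui.
  have [t tx Vt] := scott_open_finite (oUV i).2 hV.
  have subl : [set` s] `<=` [set` s ++ t] by move=> m; rewrite /= mem_cat => ->.
  exists (s ++ t); split.
  - exact: subset_trans subl.
  - exact/above_cat.
  - move=> m; rewrite ltnS leq_eqVlt => /orP[/eqP -> _|mi Um].
      apply: scott_open_up (oUV i).2 _ Vt => k.
      by rewrite /= mem_cat orbC => ->.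
    by apply: scott_open_up (oUV m).2 subl _; exact: sV.
by exists (s, a.2.+1).
Qed.

Section Correctness.
Variables (p : baire) (A : set X).
Hypotheses (cA : closed A) (A0 : A !=set0).
Hypothesis pA : enumerates p [set n | B n `&` A !=set0].

Lemma search_hits t : pre (search p t).1 `&` A !=set0.
Proof.
elim: t => [|t IH]; first by have [x Ax] := A0; exists x.
have [[_ [n np nb]]|->//] := search_succ p t.
have /enumeratesP /(_ n) [_ H] := pA.
have [|x [nx Ax]] := H; last by exists x; split=> //; exact: nb.
by move/mapP : np => [k _ pk]; exists k.
Qed.

Lemma search_mono t t' : t <= t' ->
  above (search p t).1 [set` (search p t').1] /\
  (search p t).2 <= (search p t').2.
Proof.
move=> /subnK <-; elim: (t' - t) => [|d [IH1 IH2]]; first by split.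
rewrite addSn; have [[[e ab _] _]|->//] := search_succ p (d + t).
by split; [exact: subset_trans ab|rewrite e ltnW].
Qed.

(** If the search stayed constant, a point of A in the current [pre] would admit a step, and p
    eventually lists its certificate. *)
Lemma search_progress t :
  exists2 t', t <= t' & search_step (search p t') (search p t'.+1).
Proof.
apply: contrapT => stuck.
have const d : search p (d + t) = search p t.
  elim: d => // d IH; rewrite addSn -[RHS]IH.
  have [[st _]|//] := search_succ p (d + t).
  by case: stuck; exists (d + t) => //; exact: leq_addl.
have [x [tx Ax]] := search_hits t.
have [b ab bx] := search_step_ex tx.
have [n nx nb] := basis_sub basisB (open_pre b.1) bx.
have /enumeratesP /(_ n) [H _] := pA.
have [|k pk] := H; first by exists x.
have /search_next [] : candidates (mkseq p (k.+1 + t)) (search p (k.+1 + t)) b.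
  rewrite const; split=> //; exists n => //.
  by rewrite -pk map_f // mem_iota /= addSn ltnS leq_addr.
by move=> st _; apply: stuck; exists (k.+1 + t); rewrite ?leq_addl.
Qed.

Definition search_limit : set nat := \bigcup_t [set` (search p t).1].

Lemma search_limit_finite s : above s search_limit ->
  exists t, above s [set` (search p t).1].
Proof.
elim: s => [_|n s IH /above_cons [[t _ nt] /IH [t' st']]]; first by exists 0.
exists (maxn t t'); apply/above_cons; split.
  by have [H _] := search_mono (leq_maxl t t'); exact: H.
by have [H _] := search_mono (leq_maxr t t'); exact: subset_trans H.
Qed.

Lemma search_limit_point : exists2 x, A x & point_name B (search_output p) x.
Proof.
have counter m : exists t, m <= (search p t).2.
  elim: m => [|m [t mt]]; first by exists 0.
  have [t' tt' [e _ _]] := search_progress t; exists t'.+1; rewrite e ltnS.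
  by have [_] := search_mono tt'; exact: leq_trans.
have [x hx] : exists x, h x = search_limit.
  (* U n already holds at a finite stage; once the counter has reached n, the next genuine step
     ensures V n. *)
  apply/hUV => n Un; have [s sl Us] := scott_open_finite (oUV n).1 Un.
  have [t st] := search_limit_finite sl; have [t' nt'] := counter n.
  have [u tu [e _ uV]] := search_progress (maxn t t').
  have [tu1 _] := search_mono (leq_trans (leq_maxl t t') tu).
  have [_ tu2] := search_mono (leq_trans (leq_maxr t t') tu).
  apply: (scott_open_up (oUV n).2) (uV n _ _); first by move=> k; exists u.+1.
    by rewrite e ltnS (leq_trans nt').
  by apply: (scott_open_up (oUV n).1) Us; exact: subset_trans tu1.
have xpre t : pre (search p t).1 x by rewrite /pre /= hx => k; exists t.
(* This puts x in the closure of A and makes the output list every B n containing x. *)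
have near_x W : open W -> W x -> exists t, pre (search p t).1 `<=` W.
  move=> oW Wx; have [s] := pre_base oW Wx; rewrite hx => /search_limit_finite.
  move=> [t st] sW; exists t => y ty; apply: sW; exact: subset_trans ty.
exists x.
  apply: cA => W; rewrite nbhsE => -[G [oG Gx] GW].
  have [t tG] := near_x G oG Gx; have [y [ty Ay]] := search_hits t.
  by exists y; split=> //; exact/GW/tG.
apply/enumeratesP => n; split=> [nx|[j]].
  have [t tn] := near_x _ (open_B basisB n) nx.
  by exists (pickle (n, t)); rewrite /search_output pickleK asboolT.
rewrite /search_output; case: unpickle => // -[m t].
by case: asboolP => // tm [<-]; exact: tm.
Qed.

End Correctness.

Lemma search_realizes : mf_continuous (overt_choice basisB T0X).
Proof.
exists setT, search_output; split; first exact: search_output_continuous.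
move=> p [A cA] pA [x Ax]; split=> //.
have [||y Ay py] := @search_limit_point p A _ _ pA; [by []|by exists x|].
by exists y.
Qed.

End OvertSearch.

Theorem corollary23 (X : topologicalType) (B : nat -> set X)
    (basisB : basis (range B)) (T1X : accessible_space X) :
  quasi_polish X <->
  mf_continuous (overt_choice basisB (accessible_kolmogorov T1X)).
Proof.
split; last exact: continuous_overt_choice_quasi_polish.
move=> /quasi_polish_embedding [h [U [V [oUV open_pre pre_base hUV]]]].
exact: search_realizes oUV open_pre pre_base hUV.
Qed.
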